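(* For a 2-component oriented virtual link diagram $L=K_1\cup K_2$, the linking polynomial $L_{K_1\cup K_2}(t)=F(t)G(t)$ is well defined (independent of the colorings and lifts used to define $F$ and $G$) and is an invariant of 2-component virtual links.
   Context: Virtual link diagrams are oriented and have classical and virtual crossings; virtual links are diagrams up to generalized Reidemeister moves (classical moves $\Omega_1,\Omega_2,\Omega_3$, virtual moves $\Omega_1',\Omega_2',\Omega_3'$, and the mixed move $\Omega_3^s$ in which a strand with only virtual crossings is moved past a classical crossing). The sign of a classical crossing $c$ is $w(c)\in\{\pm1\}$. Gauss diagram of $L=K_1\cup K_2$: two oriented circles (the preimages of $K_1$ and $K_2$), with one signed arrow for each classical crossing $c$, directed from the preimage of the overcrossing (tail) to the preimage of the undercrossing (head), with sign $w(c)$. Arrows with both ends on one circle correspond to self-crossings; arrows joining the two circles correspond to classical crossings between $K_1$ and $K_2$. Let $r_\pm$ be the number of arrows of sign $\pm1$ directed from $K_1$ to $K_2$ and $l_\pm$ the number of arrows of sign $\pm1$ directed from $K_2$ to $K_1$. The span is $span(L)=|r_+-r_--l_++l_-|$; it is a virtual link invariant. Write $\mathbb{Z}_{span(L)}=\mathbb{Z}/span(L)\mathbb{Z}$ (equal to $\mathbb{Z}$ if $span(L)=0$). Coloring: let $l_1,l_2$ be the universal covers (oriented real lines) of the two circles, with all arrow endpoints (of self-crossings and non-self-crossings) lifted. The lifted endpoints cut each $l_i$ into segments. Assign an arbitrary integer to one segment of $l_i$ and label the others by the rule: travelling along the orientation, passing the tail of an arrow of sign $\varepsilon$ changes the label by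 $+\varepsilon$, passing the head of an arrow of sign $\varepsilon$ changes it by $-\varepsilon$. The labelings of $l_1$ and $l_2$ are chosen independently. Then each label is reduced to its class in $\mathbb{Z}_{span(L)}$. For each arrow $c$ joining the two circles, choose lifts of its two endpoints to $l_1$ and $l_2$ and let $N(c)\in\mathbb{Z}_{span(L)}$ be the label of the segment just before the head of $c$ minus the label of the segment just after the tail of $c$ (equivalently, just after the head minus just before the tail). For a fixed coloring, $N(c)$ does not depend on the lifts. Define $F(t)=\sum w(c)t^{N(c)}$ over arrows directed from $l_1$ to $l_2$ and $G(t)=\sum w(c)t^{N(c)}$ over arrows directed from $l_2$ to $l_1$. Exponents lie in $\mathbb{Z}_{span(L)}$, so these are elements of the group ring $\mathbb{Z}[\mathbb{Z}_{span(L)}]$, i.e. of $\mathbb{Z}[t,t^{-1}]$ if $span(L)=0$ and of $\mathbb{Z}[t,t^{-1}]/(t^{span(L)}-1)$ otherwise. *)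

(* Defs.v *)
From HB Require Import structures.
From mathcomp Require Import all_boot all_order all_algebra.
Set Implicit Arguments.
Unset Strict Implicit.
Unset Printing Implicit Defensive.
Import GRing.Theory Num.Theory.

Local Open Scope ring_scope.

(* Oriented two-component virtual link diagrams are oriented 4-valent plane   *)
(* graphs with classical or virtual vertices, given by combinatorial maps.    *)
(* A crossing is a label x : nat, and its two strands are named so that       *)
(* (direction of (x, false), direction of (x, true)) is a positively oriented *)
(* frame of the plane.  The code of a component is the cyclic word of the     *)
(* strands (x, b) met along its orientation (the empty word is a circle       *)
(* without crossings).                                                        *)

Inductive kind := Virtual | Positive | Negative.

Definition classical (k : kind) : bool := if k is Virtual then false else true.

Definition kind_sign (k : kind) : int :=
  match k with Virtual => 0 | Positive => 1 | Negative => - 1 end.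

(* A classical crossing is positive when the frame (over, under) is positive, *)
(* i.e. when its strand false is the over one.                                *)
Definition is_over (k : kind) (b : bool) : bool :=
  match k with Virtual => false | Positive => ~~ b | Negative => b end.

Definition strand := (nat * bool)%type.

Record vcode := VCode {
  comp1 : seq strand;
  comp2 : seq strand;
  kind_of : nat -> kind
}.

Definition strands (D : vcode) : seq strand := comp1 D ++ comp2 D.

Definition wf_vcode (D : vcode) : bool :=
  uniq (strands D) && all (fun v => (v.1, ~~ v.2) \in strands D) (strands D).

Definition succ_strand (D : vcode) (v : strand) : strand :=
  if v \in comp1 D then next (comp1 D) v else next (comp2 D) v.

Definition pred_strand (D : vcode) (v : strand) : strand :=
  if v \in comp1 D then prev (comp1 D) v else prev (comp2 D) v.

(* Half-edges: (v, true) leaves the crossing along the strand v and           *)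
(* (v, false) enters it along v.                                              *)
Definition half_edge := (strand * bool)%type.

Definition half_edges (D : vcode) : seq half_edge :=
  [seq (v, o) | v <- strands D, o <- [:: true; false]].

(* The other half of the same edge. *)
Definition edge_perm (D : vcode) (d : half_edge) : half_edge :=
  if d.2 then (succ_strand D d.1, false) else (pred_strand D d.1, true).

(* The next half-edge counterclockwise around the crossing; the order is      *)
(* false-out, true-out, false-in, true-in.                                    *)
Definition node_perm (d : half_edge) : half_edge :=
  let: (x, b, o) := d in (x, ~~ b, o (+) b).

Definition n_orbits (D : vcode) (e : rel half_edge) : nat :=
  n_comp (fun d d' : seq_sub (half_edges D) => e (ssval d) (ssval d')) predT.

(* Euler's formula, summed over the connected components of the graph: each   *)
(* of them is drawn on a sphere.  The code records neither the outer face nor *)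
(* the relative position of disconnected pieces of the drawing; changing them *)
(* only takes virtual moves.                                                  *)
Definition planar (D : vcode) : bool :=
  let node := [rel d d' | node_perm d == d'] in
  let edge := [rel d d' | edge_perm D d == d'] in
  let face := [rel d d' | node_perm (edge_perm D d) == d'] in
  let glink := [rel d d' | node d d' || edge d d'] in
  (n_orbits D node + n_orbits D face ==
   n_orbits D edge + 2 * n_orbits D glink)%N.

Record vdiagram := VDiagram {
  code :> vcode;
  _ : wf_vcode code;
  _ : planar code
}.

(* The same diagram up to base points, crossing names and the order of the    *)
(* components.                                                                *)
Definition same_diagram (D D' : vcode) : Prop :=
  exists (f : nat -> nat) (n1 n2 : nat),
  let rename := map (fun v : strand => (f v.1, v.2)) in
  [/\ injective f,
      forall v, v \in strands D -> kind_of D' (f v.1) = kind_of D v.1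
    & (comp1 D' = rot n1 (rename (comp1 D)) /\
       comp2 D' = rot n2 (rename (comp2 D))) \/
      (comp1 D' = rot n1 (rename (comp2 D)) /\
       comp2 D' = rot n2 (rename (comp1 D)))].

Definition adjacent (D : vcode) (u v : strand) : bool :=
  (u \in strands D) && (succ_strand D u == v).

Definition erase (xs : seq nat) (D : vcode) : vcode :=
  let er := filter (fun v : strand => v.1 \notin xs) in
  VCode (er (comp1 D)) (er (comp2 D)) (kind_of D).

(* Moves Omega_1 and Omega_1': D is D' with a one-edged face removed. *)
Definition move1 (D D' : vcode) : Prop :=
  exists (x : nat) (b : bool),
    adjacent D' (x, b) (x, ~~ b) /\ D = erase [:: x] D'.

(* Moves Omega_2 and Omega_2': D is D' with a two-edged face removed; its two *)
(* sides are parallel or antiparallel.  When x and y are classical of         *)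
(* opposite signs, the same side is over at both of them.                     *)
Definition move2 (D D' : vcode) : Prop :=
  exists (x y : nat) (b : bool),
  [/\ x != y,
      adjacent D' (x, b) (y, ~~ b),
      adjacent D' (x, ~~ b) (y, b) \/ adjacent D' (y, b) (x, ~~ b),
      match kind_of D' x, kind_of D' y with
      | Virtual, Virtual | Positive, Negative | Negative, Positive => True
      | _, _ => False
      end
    & D = erase [:: x; y] D'].

(* Third moves.  Three arcs A, B, C bound a triangular face; x is the         *)
(* crossing of A and B, y that of B and C, z that of C and A; A is the strand *)
(* i of x, B the strand j of y and C the strand k of z.  For three oriented   *)
(* lines with given pairwise orientations (i, j, k), only two of the eight    *)
(* choices of orders of the crossings along the lines occur (one for each     *)
(* side of the crossing x on which C passes); they are indexed by s.  The     *)
(* move reverses the order along each of the three arcs.                      *)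
Definition triangle (D : vcode) (x y z : nat) (i j k : bool) : Prop :=
  let along (first : bool) u v :=
    if first then adjacent D u v else adjacent D v u in
  exists s : bool,
  [/\ along (s (+) j) (x, i) (z, ~~ k),
      along (s (+) k) (y, j) (x, ~~ i)
    & along (s (+) i) (z, k) (y, ~~ j)].

Definition flip_triangle (x y z : nat) (i j k : bool) : strand -> strand :=
  [eta id with (x, i) |-> (z, ~~ k), (z, ~~ k) |-> (x, i),
               (y, j) |-> (x, ~~ i), (x, ~~ i) |-> (y, j),
               (z, k) |-> (y, ~~ j), (y, ~~ j) |-> (z, k)].

(* Omega_3: three classical crossings, the relation "passes over" among       *)
(* A, B, C not being cyclic.  Omega_3': three virtual crossings.  Omega_3^s:  *)
(* one classical crossing, the third arc having only virtual crossings.       *)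
Definition triangle_kinds (D : vcode) (x y z : nat) (i j k : bool) : Prop :=
  match kind_of D x, kind_of D y, kind_of D z with
  | Virtual, Virtual, _ | Virtual, _, Virtual | _, Virtual, Virtual => True
  | Virtual, _, _ | _, Virtual, _ | _, _, Virtual => False
  | kx, ky, kz =>
      ~~ ((is_over kx i == is_over ky j) && (is_over ky j == is_over kz k))
  end.

Definition move3 (D D' : vcode) : Prop :=
  exists (x y z : nat) (i j k : bool),
  [/\ uniq [:: x; y; z],
      triangle D x y z i j k,
      triangle_kinds D x y z i j k
    & let fl := map (flip_triangle x y z i j k) in
      D' = VCode (fl (comp1 D)) (fl (comp2 D)) (kind_of D)].

(* Two diagrams represent the same two-component virtual link.  The moves are *)
(* taken between plane diagrams only.                                         *)
Inductive vlink_equiv : vdiagram -> vdiagram -> Prop :=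
| vlink_same (D D' : vdiagram) : same_diagram D D' -> vlink_equiv D D'
| vlink_move1 (D D' : vdiagram) : move1 D D' -> vlink_equiv D D'
| vlink_move2 (D D' : vdiagram) : move2 D D' -> vlink_equiv D D'
| vlink_move3 (D D' : vdiagram) : move3 D D' -> vlink_equiv D D'
| vlink_sym (D D' : vdiagram) : vlink_equiv D D' -> vlink_equiv D' D
| vlink_trans (D D' D'' : vdiagram) :
    vlink_equiv D D' -> vlink_equiv D' D'' -> vlink_equiv D D''.

(* Gauss diagrams: (c, true) is the tail and (c, false) the head of the arrow *)
(* c; a circle is the cyclic word of the arrow ends on it.                    *)
Definition arrow_end := (nat * bool)%type.

Record gauss_diagram := GaussDiagram {
  circle1 : seq arrow_end;
  circle2 : seq arrow_end;
  sign : nat -> int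
}.

Definition gauss_circle (kd : nat -> kind) (K : seq strand) : seq arrow_end :=
  [seq (v.1, is_over (kd v.1) v.2) | v <- K & classical (kd v.1)].

Definition gauss (D : vcode) : gauss_diagram :=
  GaussDiagram (gauss_circle (kind_of D) (comp1 D))
               (gauss_circle (kind_of D) (comp2 D))
               (fun x => kind_sign (kind_of D x)).

(* The arrows directed from the circle A to the circle B. *)
Definition arrows (A B : seq arrow_end) : seq nat :=
  [seq e.1 | e <- A & e.2 && ((e.1, false) \in B)].

Definition n_arrows (g : gauss_diagram) (A B : seq arrow_end) (eps : int)
    : nat :=
  count (fun c => sign g c == eps) (arrows A B).

Definition link_span (g : gauss_diagram) : nat :=
  let r eps : int := (n_arrows g (circle1 g) (circle2 g) eps)%:Z in
  let l eps : int := (n_arrows g (circle2 g) (circle1 g) eps)%:Z in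
  absz (r 1 - r (- 1) - l 1 + l (- 1)).

(* On the universal cover of a circle A, the lifted arrow ends are numbered   *)
(* by int along the orientation; cover_end A k is the arrow end below the     *)
(* k-th one (None if there is no arrow end on A).                             *)
Definition cover_end (A : seq arrow_end) (k : int) : option arrow_end :=
  onth A (absz (k %% (size A)%:Z)%Z).

(* The segment k of the cover lies between the lifted ends k - 1 and k.  The  *)
(* labels are kept in int; they are reduced modulo the span in arrow_index.   *)
Definition coloring (g : gauss_diagram) (A : seq arrow_end) (lab : int -> int)
    : Prop :=
  forall k : int,
    lab (k + 1) =
    lab k + match cover_end A k with
            | Some (c, true) => sign g c
            | Some (c, false) => - sign g c
            | None => 0
            end.

(* Labelings of the covers of the two circles, and for each arrow joining     *)
(* them the numbers of the chosen lifts of its tail and of its head.          *)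
Record choices := Choices {
  label1 : int -> int;
  label2 : int -> int;
  tail_lift : nat -> int;
  head_lift : nat -> int
}.

Definition valid_lifts (A B : seq arrow_end) (C : choices) : Prop :=
  forall c, c \in arrows A B ->
    cover_end A (tail_lift C c) = Some (c, true) /\
    cover_end B (head_lift C c) = Some (c, false).

Definition valid_choices (g : gauss_diagram) (C : choices) : Prop :=
  [/\ coloring g (circle1 g) (label1 C),
      coloring g (circle2 g) (label2 C),
      valid_lifts (circle1 g) (circle2 g) C
    & valid_lifts (circle2 g) (circle1 g) C].

(* N(c), as the canonical representative of its class in Z / span Z (recall   *)
(* that (m %% 0)%Z = m): the label of the segment just before the head minus  *)
(* the label of the segment just after the tail.                              *)
Definition arrow_index (g : gauss_diagram) (C : choices)
    (lab_tail lab_head : int -> int) (c : nat) : int :=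
  ((lab_head (head_lift C c) - lab_tail (tail_lift C c + 1)%R)
     %% (link_span g)%:Z)%Z.

(* Laurent polynomials are taken in the fraction field Z(t). *)
Definition ratfun := {fraction {poly int}}.

Definition tvar : ratfun := FracField.tofrac 'X.

Definition linkF (g : gauss_diagram) (C : choices) : ratfun :=
  \sum_(c <- arrows (circle1 g) (circle2 g))
     (sign g c)%:~R * tvar ^ arrow_index g C (label1 C) (label2 C) c.

Definition linkG (g : gauss_diagram) (C : choices) : ratfun :=
  \sum_(c <- arrows (circle2 g) (circle1 g))
     (sign g c)%:~R * tvar ^ arrow_index g C (label2 C) (label1 C) c.

Definition linking_polynomial (D : vcode) (C : choices) : ratfun :=
  linkF (gauss D) C * linkG (gauss D) C.

(* Equality in Z[t, t^-1] / (t^s - 1) = Z[Z / s Z]; for s = 0 it is equality. *)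
Definition laurent_eqmod (s : nat) (P Q : ratfun) : Prop :=
  exists (q : {poly int}) (n : nat),
    P - Q = (tvar ^+ s - 1) * (FracField.tofrac q / tvar ^+ n).

(* Main.v *)
(* Work with labelings of the strands of the code modulo the span, virtual
   crossings included: the label changes by [jump] along each strand.  Any such
   labeling computes the polynomial, because a coloring of a universal cover
   differs from it by a constant on each component; constants [a] and [b]
   multiply F by t^(b - a) and G by t^(a - b), and these factors cancel in FG.
   The sum of the jumps along a component is the span up to sign, since the
   ends of a self-crossing cancel.

   Each move changes the jumps by the coboundary of a function supported near
   the move: the first two kill the jumps of the erased strands, the third one
   exchanges the jumps of the two strands on each side of the triangle.  Adding
   this function to a labeling gives a labeling of the new diagram, and sums of
   jumps along components do not change.  The indices of the surviving crossings
   are unchanged: for the third moves the labels at the two strands of each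
   crossing of the triangle change by the same amount.  The two crossings erased
   by a second move have opposite signs and equal indices. *)
Require Import Defs.
From mathcomp Require Import all_boot all_order all_algebra.
From mathcomp Require Import ring zify.
Set Implicit Arguments.
Unset Strict Implicit.
Unset Printing Implicit Defensive.
Import GRing.Theory Num.Theory.

Local Open Scope ring_scope.

(** * Integers modulo the span *)

(** For [s = 0] this is equality, since 0 divides only 0. *)
Definition congr_mod (s : nat) (a b : int) : bool := (s%:Z %| a - b)%Z.

Lemma congr_mod_refl s a : congr_mod s a a.
Proof. by rewrite /congr_mod subrr dvdz0. Qed.

Lemma congr_mod_sym s a b : congr_mod s a b = congr_mod s b a.
Proof. by rewrite /congr_mod -rpredN opprB. Qed.

Lemma congr_modD s a b c d :
  congr_mod s a b -> congr_mod s c d -> congr_mod s (a + c) (b + d).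
Proof.
rewrite /congr_mod => h k.
by have -> : a + c - (b + d) = (a - b) + (c - d); [ring | exact: rpredD].
Qed.

Lemma congr_modB s a b c d :
  congr_mod s a b -> congr_mod s c d -> congr_mod s (a - c) (b - d).
Proof.
move=> h; rewrite congr_mod_sym => k; apply: congr_modD => //.
by move: k; rewrite /congr_mod opprK addrC.
Qed.

Lemma congr_mod_trans s b a c :
  congr_mod s a b -> congr_mod s b c -> congr_mod s a c.
Proof.
rewrite /congr_mod => h k.
by have -> : a - c = (a - b) + (b - c); [ring | exact: rpredD].
Qed.

Lemma congr_modDr s c a b : congr_mod s (a + c) (b + c) = congr_mod s a b.
Proof. by rewrite /congr_mod opprD addrACA subrr addr0. Qed.

Lemma congr_mod_modz s a : congr_mod s (a %% s%:Z)%Z a.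
Proof. by rewrite /congr_mod -eqz_mod_dvd modz_mod. Qed.

(** * Laurent polynomials modulo t^s - 1 *)

(** The ring Z[t, 1/t] inside Z(t). In the field t^s - 1 is invertible for s > 0, so a congruence
    has content only if the cofactor is a Laurent polynomial. *)
Definition laurent (P : ratfun) : Prop :=
  exists (q : {poly int}) (n : nat), P = FracField.tofrac q / tvar ^+ n.

Lemma tvar_neq0 : tvar != 0.
Proof. by rewrite tofrac_eq0 polyX_eq0. Qed.

Lemma laurentD P Q : laurent P -> laurent Q -> laurent (P + Q).
Proof.
move=> [p [m ->]] [q [n ->]]; exists (p * 'X^n + q * 'X^m), (m + n)%N.
by rewrite tofracD !tofracM !tofracXn exprD addf_div // expf_neq0 ?tvar_neq0.
Qed.

Lemma laurentM P Q : laurent P -> laurent Q -> laurent (P * Q).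
Proof.
move=> [p [m ->]] [q [n ->]]; exists (p * q), (m + n)%N.
by rewrite tofracM exprD mulf_div.
Qed.

Lemma laurent_tofrac p : laurent (FracField.tofrac p).
Proof. by exists p, 0%N; rewrite divr1. Qed.

Lemma laurent_int (z : int) : laurent z%:~R.
Proof.
have -> : z%:~R = FracField.tofrac z%:~R :> ratfun by rewrite rmorph_int.
exact: laurent_tofrac.
Qed.

Lemma laurentN P : laurent P -> laurent (- P).
Proof.
move=> lP; rewrite -mulN1r -(mulrN1z 1).
by apply: laurentM => //; apply: laurent_int.
Qed.

Lemma laurent_exp (k : int) : laurent (tvar ^ k).
Proof.
case: k => n; first by rewrite -exprnP -tofracXn; apply: laurent_tofrac.
by rewrite NegzE -exprnN; exists 1, n.+1; rewrite tofrac1 mul1r.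
Qed.

Lemma laurent_sum (I : Type) (r : seq I) (p : pred I) F :
  (forall i, p i -> laurent (F i)) -> laurent (\sum_(i <- r | p i) F i).
Proof.
move=> lF; apply: big_ind => //; last exact: laurentD.
exact: (laurent_int 0).
Qed.

Section LaurentMod.
Variable s : nat.
Local Notation "P =l Q" := (laurent_eqmod s P Q) (at level 70).

Lemma laurent_eqmodP P Q :
  P =l Q <-> exists2 R, laurent R & P - Q = (tvar ^+ s - 1) * R.
Proof.
split=> [[q [n e]] | [R [q [n ->]] e]]; last by exists q, n.
by exists (FracField.tofrac q / tvar ^+ n) => //; exists q, n.
Qed.

Lemma laurent_eqmod_refl P : P =l P.
Proof.
by apply/laurent_eqmodP; exists 0; [exact: (laurent_int 0) | rewrite subrr mulr0].
Qed.

Lemma laurent_eqmod_sym P Q : P =l Q -> Q =l P.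
Proof.
move=> /laurent_eqmodP[R lR e]; apply/laurent_eqmodP; exists (- R); first exact: laurentN.
by rewrite mulrN -e opprB.
Qed.

Lemma laurent_eqmod_trans Q P R : P =l Q -> Q =l R -> P =l R.
Proof.
move=> /laurent_eqmodP[U lU eU] /laurent_eqmodP[V lV eV]; apply/laurent_eqmodP.
exists (U + V); first exact: laurentD.
by rewrite mulrDr -eU -eV addrA subrK.
Qed.

Lemma laurent_eqmodD P Q P' Q' : P =l Q -> P' =l Q' -> P + P' =l Q + Q'.
Proof.
move=> /laurent_eqmodP[U lU eU] /laurent_eqmodP[V lV eV]; apply/laurent_eqmodP.
exists (U + V); first exact: laurentD.
by rewrite mulrDr -eU -eV opprD addrACA.
Qed.

Lemma laurent_eqmodMl R P Q : laurent R -> P =l Q -> R * P =l R * Q.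
Proof.
move=> lR /laurent_eqmodP[U lU eU]; apply/laurent_eqmodP.
by exists (R * U); [exact: laurentM | rewrite -mulrBr eU mulrCA].
Qed.

Lemma laurent_eqmodM P Q P' Q' :
  laurent Q -> laurent P' -> P =l Q -> P' =l Q' -> P * P' =l Q * Q'.
Proof.
move=> lQ lP' h h'; apply: (@laurent_eqmod_trans (Q * P')).
  by rewrite ![_ * P']mulrC; apply: laurent_eqmodMl.
exact: laurent_eqmodMl.
Qed.

Lemma laurent_eqmod_sum (I : eqType) (r : seq I) (p : pred I) F G :
  (forall i, i \in r -> p i -> F i =l G i) ->
  \sum_(i <- r | p i) F i =l \sum_(i <- r | p i) G i.
Proof.
elim: r => [|i r IH] h; first by rewrite !big_nil; apply: laurent_eqmod_refl.
have {}IH : \sum_(i <- r | p i) F i =l \sum_(i <- r | p i) G i.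
  by apply: IH => j jr; apply: h; rewrite inE jr orbT.
rewrite !big_cons; case: ifP => // pi.
by apply: laurent_eqmodD => //; apply: h; rewrite // mem_head.
Qed.

(** The polynomial t^(s q) - 1 is t^s - 1 times a geometric sum. For a negative quotient [a] and [b]
    exchange roles. *)
Lemma laurent_eqmod_exp (a b : int) : congr_mod s a b -> tvar ^ a =l tvar ^ b.
Proof.
suff main (m : int) (q : nat) : tvar ^ (m + (s * q)%:Z) =l tvar ^ m.
  move=> /dvdzP[[q|q] e].
    by have -> : a = b + (s * q)%:Z by lia.
  apply: laurent_eqmod_sym.
  by have -> : b = a + (s * q.+1)%:Z by lia.
apply/laurent_eqmodP; exists (tvar ^ m * \sum_(i < q) (tvar ^+ s) ^+ i).
  apply: laurentM; first exact: laurent_exp.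
  by apply: laurent_sum => i _; rewrite -exprM; apply: (laurent_exp (s * i)%N).
rewrite expfzDr ?tvar_neq0 // mulrCA -subrX1 mulrBr mulr1.
by rewrite -exprM.
Qed.

End LaurentMod.

(** * Cyclic labelings *)

Section Labelings.
Variables (T : eqType) (s : nat).
Implicit Types (K : seq T) (d L : T -> int).

(** Here [L v] is the label of the edge that enters [v], and [d u] is the change of the label along
    [u]. *)
Definition label_step d L : rel T :=
  fun u v => congr_mod s (L v) (L u + d u).

Lemma filter_rot (p : pred T) n K :
  exists m, filter p (rot n K) = rot m (filter p K).
Proof.
exists (size (filter p (take n K))).
have -> : filter p K = filter p (take n K) ++ filter p (drop n K).
  by rewrite -filter_cat cat_take_drop.
by rewrite rot_size_cat /rot filter_cat.
Qed.

(** In the induction [x] is the last letter kept and [y] the last one read. The labels leaving them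
    agree because the letters dropped in between have zero jump. *)
Lemma filter_label_path (p : pred T) d L K x y z :
  (forall v, ~~ p v -> d v = 0) -> p z ->
  congr_mod s (L x + d x) (L y + d y) ->
  path (label_step d L) y (rcons K z) ->
  path (label_step d L) x (rcons (filter p K) z).
Proof.
move=> d0 pz; elim: K x y => [|v K IH] x y exy /=.
  rewrite !andbT => /congr_mod_trans; apply.
  by rewrite congr_mod_sym.
case/andP => yv pK; case: ifP => [pv | npv] /=.
  rewrite (IH v v) ?congr_mod_refl // andbT.
  by apply: congr_mod_trans yv _; rewrite congr_mod_sym.
apply: IH pK; apply: congr_mod_trans exy _.
by rewrite congr_mod_sym d0 ?npv // addr0.
Qed.

Lemma filter_label_cycle (p : pred T) d L K :
  (forall v, ~~ p v -> d v = 0) ->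
  cycle (label_step d L) K -> cycle (label_step d L) (filter p K).
Proof.
move=> d0 cK; case: (altP (@hasP _ p K)) => [[v vK pv] | /negP npK]; last first.
  rewrite (_ : filter p K = [::]) //; apply/eqP.
  by rewrite -[_ == _]negbK -has_filter; apply/negP.
(* After a rotation the word starts with a kept letter, so the word and its filtered form are closed
   up by the same letter. *)
have [i K' eK] := rot_to vK; have [m em] := filter_rot p i K.
rewrite -(rot_cycle m) -em eK /= pv.
move: cK; rewrite -(rot_cycle i) eK /=; apply: filter_label_path => //.
exact: congr_mod_refl.
Qed.

(** The partial sums of [d] from the base point form a labeling; it closes up because the total is
    zero modulo [s]. *)
Lemma label_cycle_exists d K :
  uniq K -> congr_mod s (\sum_(v <- K) d v) 0 ->
  exists L, cycle (label_step d L) K.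
Proof.
move=> uK sK; exists (fun v => \sum_(u <- take (index v K) K) d u).
case: K uK sK => // x K uK sK; rewrite /cycle.
apply/(pathP x) => i; rewrite size_rcons -[(size K).+1]/(size (x :: K)) => lti.
rewrite -rcons_cons !nth_rcons lti /label_step (index_uniq x lti uK).
have e : \sum_(u <- take i (x :: K)) d u + d (nth x (x :: K) i) =
    \sum_(u <- take i.+1 (x :: K)) d u.
  by rewrite (take_nth x) // -cats1 big_cat big_seq1.
rewrite e; move: (lti); rewrite ltnS leq_eqVlt => /orP[/eqP-> | ltiK].
  by rewrite ltnn eqxx index_head take0 big_nil congr_mod_sym take_oversize.
rewrite ltiK -[nth x K i]/(nth x (x :: K) i.+1).
by rewrite index_uniq // congr_mod_refl.
Qed.

(** The sum of a coboundary along a circle vanishes, because [next K] permutes the letters of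
    [K]. *)
Lemma label_cycle_shift d L e K :
  uniq K ->
  (forall v, v \in K -> e v = d v + L (next K v) - L v) ->
  \sum_(v <- K) e v = \sum_(v <- K) d v.
Proof.
move=> uK h; rewrite big_seq (eq_bigr _ h) -big_seq.
rewrite sumrB big_split /= -addrA; set X := _ - _.
suff -> : X = 0 by rewrite addr0.
apply/eqP; rewrite subr_eq0 -(big_map (next K) xpredT L); apply/eqP/perm_big.
suff -> : map (next K) K = rot 1 K by rewrite perm_rot.
case: K uK {h X} => // x K uK.
rewrite rot1_cons; apply: (@eq_from_nth _ x); rewrite size_map ?size_rcons // => i ltiK.
rewrite (nth_map x) // next_nth mem_nth // index_uniq // nth_rcons.
case: ltnP => leiK //.
by rewrite nth_default //; case: eqP.
Qed.

End Labelings.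

(** * Labelings of codes *)

Definition opp_strand (v : strand) : strand := (v.1, ~~ v.2).

Lemma opp_strandK : involutive opp_strand.
Proof. by case=> x b; rewrite /opp_strand /= negbK. Qed.

(* The change of the label along a strand: the over strand changes it by the
   sign [e] of the crossing, the under strand by [- e].  Since the over strand
   is [false] when [e = 1] and [true] when [e = - 1], only the strand matters. *)
Definition jump (kd : nat -> kind) (v : strand) : int :=
  if classical (kd v.1) then (-1) ^+ v.2 else 0.

Lemma jump_opp (kd : nat -> kind) (v : strand) : jump kd (opp_strand v) = - jump kd v.
Proof.
rewrite /jump /=; case: ifP => _; last by rewrite oppr0.
by case: v.2; rewrite ?opprK.
Qed.

Lemma jump_over (kd : nat -> kind) (v : strand) :
  is_over (kd v.1) v.2 -> jump kd v = kind_sign (kd v.1).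
Proof. by rewrite /jump; case: (kd v.1) => //=; case: v.2. Qed.

(** This is the rule of [coloring] at the tail (over strand) or the head (under strand) of the
    arrow. *)
Lemma jump_gauss (kd : nat -> kind) (v : strand) : classical (kd v.1) ->
  jump kd v =
  if is_over (kd v.1) v.2 then kind_sign (kd v.1) else - kind_sign (kd v.1).
Proof. by rewrite /jump; case: (kd v.1) => //=; case: v.2. Qed.

Lemma is_over_opp (kd : nat -> kind) (v : strand) : classical (kd v.1) ->
  is_over (kd v.1) (~~ v.2) = ~~ is_over (kd v.1) v.2.
Proof. by case: (kd v.1) => //=. Qed.

Lemma is_over_classical (kd : nat -> kind) (v : strand) :
  is_over (kd v.1) v.2 -> classical (kd v.1).
Proof. by case: (kd v.1). Qed.

Section Codes.
Variable D : vcode.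
Hypothesis wfD : wf_vcode D.

Lemma wf_uniq : uniq (strands D).
Proof. by case/andP: wfD. Qed.

Lemma wf_uniq1 : uniq (comp1 D).
Proof. by have := wf_uniq; rewrite cat_uniq => /and3P[]. Qed.

Lemma wf_uniq2 : uniq (comp2 D).
Proof. by have := wf_uniq; rewrite cat_uniq => /and3P[]. Qed.

Lemma wf_comp12 v : v \in comp1 D -> v \in comp2 D -> False.
Proof.
move=> v1 v2; have := wf_uniq; rewrite cat_uniq => /and3P[_ /hasPn h _].
by move/negP: (h v v2); apply.
Qed.

Lemma mem_comp2 v : v \in strands D -> (v \in comp2 D) = (v \notin comp1 D).
Proof.
rewrite mem_cat; case v1: (v \in comp1 D) => /=; last by move->.
by move=> _; apply/negP; apply: wf_comp12.
Qed.

Lemma wf_opp v : (opp_strand v \in strands D) = (v \in strands D).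
Proof.
case/andP: wfD => _ /allP h; apply/idP/idP => [/h|/h //].
by rewrite negbK; case: v.
Qed.

Lemma mem_succ v : v \in strands D -> (succ_strand D v \in comp1 D) = (v \in comp1 D).
Proof.
rewrite /succ_strand; case: ifP => [v1 _ | v1]; first by rewrite mem_next.
rewrite mem_cat v1 /= => v2; apply/negP => v3.
by apply: (wf_comp12 v3); rewrite mem_next.
Qed.

Lemma succ_mem v : v \in strands D -> succ_strand D v \in strands D.
Proof.
rewrite /succ_strand !mem_cat; case: ifP => v1 /=; first by rewrite mem_next v1.
by move=> v2; rewrite mem_next v2 orbT.
Qed.

Lemma succ_inj : {in strands D &, injective (succ_strand D)}.
Proof.
move=> u v uD vD e; have := mem_succ uD; rewrite e (mem_succ vD).
move: e; rewrite /succ_strand => + h; rewrite -h; case: ifP => _.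
  exact: (can_inj (prev_next wf_uniq1)).
exact: (can_inj (prev_next wf_uniq2)).
Qed.

Lemma adjacent_comp1 u v : adjacent D u v -> (u \in comp1 D) = (v \in comp1 D).
Proof. by case/andP=> uD /eqP<-; rewrite mem_succ. Qed.

Lemma adjacent_mem u v : adjacent D u v -> u \in strands D /\ v \in strands D.
Proof. by case/andP=> uD /eqP<-; rewrite uD succ_mem. Qed.

Lemma adjacent_comp2 u v : adjacent D u v -> (u \in comp2 D) = (v \in comp2 D).
Proof.
move=> uv; have [uD vD] := adjacent_mem uv.
by rewrite !mem_comp2 // (adjacent_comp1 uv).
Qed.

End Codes.

Definition labeling s (d : strand -> int) L D : bool :=
  cycle (label_step s d L) (comp1 D) && cycle (label_step s d L) (comp2 D).

(** The cyclic form suits filtering and rotation of words; this pointwise form suits arguments about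
    adjacent strands. *)
Lemma labelingP s d L D : wf_vcode D ->
  reflect {in strands D, forall v, label_step s d L v (succ_strand D v)}
          (labeling s d L D).
Proof.
move=> wfD; have succ1 v : v \in comp1 D -> succ_strand D v = next (comp1 D) v.
  by rewrite /succ_strand => ->.
have succ2 v : v \in comp2 D -> succ_strand D v = next (comp2 D) v.
  by rewrite /succ_strand; case: ifP => // v1 /(wf_comp12 wfD v1).
apply: (iffP andP) => [[c1 c2] v | h].
  rewrite mem_cat => /orP[v1|v2]; first by rewrite succ1 // next_cycle.
  by rewrite succ2 // next_cycle.
split; apply: cycle_from_next; rewrite ?wf_uniq1 ?wf_uniq2 // => v vD.
  by rewrite -succ1 // h // mem_cat vD.
by rewrite -succ2 // h // mem_cat vD orbT.
Qed.

(** * Local modifications of labelings *)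

Section Coboundary.
Variables (D : vcode) (d e : strand -> int) (bs : seq (strand * strand)).
Hypothesis wfD : wf_vcode D.
Hypothesis bs_adj : {in bs, forall b : strand * strand, adjacent D b.1 b.2}.
Hypothesis bs_disj : {in bs, forall b : strand * strand, b.1 \notin unzip2 bs}.
Hypothesis bs_sum : {in bs, forall b : strand * strand, e b.1 + e b.2 = d b.1 + d b.2}.
Hypothesis bs_out : forall v : strand,
  v \notin unzip1 bs -> v \notin unzip2 bs -> e v = d v.

(** A pair of [bs] keeps its total jump, so only the label between its two strands changes, by e b.1
    - d b.1 = d b.2 - e b.2. *)
Definition shift (v : strand) : int := if v \in unzip2 bs then d v - e v else 0.

(** The functions [d] and [e] differ by the coboundary of [shift]. By injectivity of the successor,
    the strand after [v] is the second one of a pair only if [v] is its first one. *)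
Lemma shift_succ v : v \in strands D ->
  e v + shift v = d v + shift (succ_strand D v).
Proof.
move=> vD; case v1: (v \in unzip1 bs).
  have {v1 vD} /mapP[b bbs ->] := v1.
  have /andP[_ /eqP->] := bs_adj bbs.
  rewrite /shift (negPf (bs_disj bbs)) map_f // addr0.
  by rewrite addrA -(bs_sum bbs) addrK.
rewrite {2}/shift; case: ifP => [/mapP[b bbs vb] | _].
  have /andP[b1 /eqP b2] := bs_adj bbs.
  move: vb; rewrite -b2 => /(succ_inj wfD vD b1) vb.
  by rewrite vb map_f in v1.
rewrite addr0 /shift; case: ifP => v2; first by rewrite addrC subrK.
by rewrite bs_out ?v1 ?v2 // addr0.
Qed.

Lemma labeling_shift s L :
  labeling s d L D -> labeling s e (fun v => L v + shift v) D.
Proof.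
move=> /(labelingP _ _ _ wfD) lab; apply/labelingP => // v vD.
rewrite /label_step -addrA [shift v + _]addrC shift_succ // addrA congr_modDr.
exact: lab.
Qed.

Lemma sum_shift1 : \sum_(v <- comp1 D) e v = \sum_(v <- comp1 D) d v.
Proof.
apply: (@label_cycle_shift _ d shift); first exact: wf_uniq1.
move=> v v1; apply/eqP; rewrite -(inj_eq (addIr (shift v))) subrK.
rewrite shift_succ ?mem_cat ?v1 //.
by rewrite /succ_strand v1.
Qed.

End Coboundary.

(** * Gauss diagrams *)

Section GaussCircles.
Variable kd : nat -> kind.
Implicit Types A B : seq strand.

(** A classical crossing has one over and one under strand, so an arrow end determines its
    strand. *)
Lemma is_over_inj (v w : strand) : classical (kd v.1) -> v.1 = w.1 ->
  is_over (kd v.1) v.2 = is_over (kd w.1) w.2 -> v = w.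
Proof.
case: v w => [x b] [y c] /= cx <-; case: (kd x) cx => //= _; last by move->.
by move=> /negb_inj->.
Qed.

Lemma mem_gauss_circle (v : strand) A : classical (kd v.1) ->
  ((v.1, is_over (kd v.1) v.2) \in gauss_circle kd A) = (v \in A).
Proof.
move=> cv; apply/mapP/idP => [[w]|vA]; last by exists v; rewrite // mem_filter cv.
rewrite mem_filter => /andP[_ wA] [e1 e2].
by rewrite (is_over_inj cv e1 e2).
Qed.

Lemma mem_gauss_tail (v : strand) A : is_over (kd v.1) v.2 ->
  ((v.1, true) \in gauss_circle kd A) = (v \in A).
Proof.
by move=> o; rewrite -mem_gauss_circle ?(is_over_classical o) // o.
Qed.

Lemma mem_gauss_head (v : strand) A : is_over (kd v.1) v.2 ->
  ((v.1, false) \in gauss_circle kd A) = (opp_strand v \in A).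
Proof.
move=> o; rewrite -[RHS]mem_gauss_circle ?(is_over_classical o) //.
by rewrite /= is_over_opp ?(is_over_classical o) // o.
Qed.

(** An arrow is represented by its over strand, which carries the tail; the opposite strand carries
    the head. *)
Lemma big_arrows (V : nmodType) (f : nat -> V) A B :
  \sum_(c <- arrows (gauss_circle kd A) (gauss_circle kd B)) f c =
  \sum_(v <- A | is_over (kd v.1) v.2 && (opp_strand v \in B)) f v.1.
Proof.
rewrite big_map big_filter big_map big_filter_cond; apply: eq_bigl => v /=.
case o: (is_over _ _); last by rewrite andbF.
by rewrite mem_gauss_head // (is_over_classical o).
Qed.

Lemma mem_arrows c A B :
  c \in arrows (gauss_circle kd A) (gauss_circle kd B) ->
  exists v : strand, [/\ v.1 = c, is_over (kd v.1) v.2, v \in A & opp_strand v \in B].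
Proof.
case/mapP=> e; rewrite mem_filter => /andP[/andP[t h] /mapP[v]].
rewrite mem_filter => /andP[_ vA] e1 ->; move: t h; rewrite e1 /= => t h.
by exists v; rewrite -mem_gauss_head.
Qed.

End GaussCircles.

(** * The span as a sum of jumps *)

Lemma count_sign (I : Type) (r : seq I) (f : I -> kind) :
  (count (fun i => kind_sign (f i) == 1) r)%:Z -
  (count (fun i => kind_sign (f i) == - 1) r)%:Z =
  \sum_(i <- r) kind_sign (f i).
Proof.
elim: r => [|i r IH]; first by rewrite big_nil.
rewrite big_cons -IH /= !PoszD.
by case: (f i) => /=; ring.
Qed.

Section Span.
Variable D : vcode.
Hypothesis wfD : wf_vcode D.
Local Notation S := (strands D).
Local Notation jmp := (jump (kind_of D)).

Lemma perm_opp : perm_eq (map opp_strand S) S.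
Proof.
have uS := wf_uniq wfD; have oi := can_inj opp_strandK.
apply: uniq_perm; rewrite ?map_inj_uniq // => v.
by rewrite -{1}[v]opp_strandK mem_map // wf_opp.
Qed.

Lemma sum_opp (V : nmodType) (p : pred strand) (f : strand -> V) :
  \sum_(v <- S | p v) f v = \sum_(v <- S | p (opp_strand v)) f (opp_strand v).
Proof. by rewrite -(perm_big _ perm_opp) /= big_map. Qed.

(** Sums over all strands can be reindexed by [opp_strand], which need not preserve a component. *)
Lemma sum_comp1 (V : nmodType) (p : pred strand) (f : strand -> V) :
  \sum_(v <- comp1 D | p v) f v = \sum_(v <- S | (v \in comp1 D) && p v) f v.
Proof.
rewrite big_cat /= [X in _ = _ + X]big_seq_cond [X in _ = _ + X]big_pred0 ?addr0.
  by rewrite [LHS]big_seq_cond [RHS]big_seq_cond; apply: eq_bigl => v; case: (v \in _).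
move=> v; apply/negP => /and3P[v2 v1 _].
exact: (wf_comp12 wfD v1 v2).
Qed.

Lemma sum_comp2 (V : nmodType) (p : pred strand) (f : strand -> V) :
  \sum_(v <- comp2 D | p v) f v = \sum_(v <- S | (v \in comp2 D) && p v) f v.
Proof.
rewrite big_cat /= [X in _ = X + _]big_seq_cond [X in _ = X + _]big_pred0 ?add0r.
  by rewrite [LHS]big_seq_cond [RHS]big_seq_cond; apply: eq_bigl => v; case: (v \in _).
move=> v; apply/negP => /and3P[v1 v2 _].
exact: (wf_comp12 wfD v1 v2).
Qed.

(** Passing to opposite strands turns the sum into its negative. *)
Lemma sum_jump0 (p : pred strand) : (forall v, p (opp_strand v) = p v) ->
  \sum_(v <- S | p v) jmp v = 0.
Proof.
move=> pE; set X := LHS; suff : X = - X by lia.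
rewrite {1}/X sum_opp (eq_bigl p) // -sumrN.
by apply: eq_bigr => v _; rewrite jump_opp.
Qed.

Lemma sum_jump12 :
  \sum_(v <- comp2 D) jmp v = - \sum_(v <- comp1 D) jmp v.
Proof.
apply/eqP; rewrite -addr_eq0 addrC -big_cat; apply/eqP.
exact: sum_jump0.
Qed.

(** Along the first component the two jumps of a self-crossing cancel. An over strand of a mixed
    crossing contributes its sign, an under strand minus its sign, which gives r_+ - r_- - l_+ +
    l_-. *)
Lemma link_span_jump :
  link_span (gauss D) = absz (\sum_(v <- comp1 D) jmp v).
Proof.
pose cross (A B : seq strand) := \sum_(v <- S | [&& v \in A, is_over (kind_of D v.1) v.2
  & opp_strand v \in B]) kind_sign (kind_of D v.1).
have n12 : (n_arrows (gauss D) (circle1 (gauss D)) (circle2 (gauss D)) 1)%:Z -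
    (n_arrows (gauss D) (circle1 (gauss D)) (circle2 (gauss D)) (- 1))%:Z =
    cross (comp1 D) (comp2 D).
  by rewrite count_sign big_arrows sum_comp1.
have n21 : (n_arrows (gauss D) (circle2 (gauss D)) (circle1 (gauss D)) 1)%:Z -
    (n_arrows (gauss D) (circle2 (gauss D)) (circle1 (gauss D)) (- 1))%:Z =
    cross (comp2 D) (comp1 D).
  by rewrite count_sign big_arrows sum_comp2.
rewrite /link_span; congr absz.
rewrite -addrA [- _ + _]addrC -[X in _ + X]opprB n12 n21 => {n12 n21}.
(* The crossings with both strands on the first component are split off; their jumps sum to zero. *)
rewrite sum_comp1 (bigID (fun v => opp_strand v \in comp1 D)) /=.
rewrite [X in _ = X + _]sum_jump0 ?add0r; last first.
  by move=> v; rewrite opp_strandK !andbT andbC.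
rewrite (bigID (fun v : strand => is_over (kind_of D v.1) v.2)) /=; congr (_ + _).
  rewrite /cross big_seq_cond [RHS]big_seq_cond.
  apply: eq_big => [v | v /and4P[_ _ o _]]; last by rewrite jump_over.
  case vS: (v \in S) => //=; rewrite mem_comp2 ?wf_opp // andbT.
  by case: (is_over _ _); rewrite ?andbF //= ?andbT.
(* The under strands on the first component are replaced by their opposites, the tails of the arrows
   from the second component to the first. *)
rewrite [RHS]sum_opp -sumrN big_seq_cond [RHS]big_seq_cond.
rewrite [RHS]big_mkcond [LHS]big_mkcond; apply: eq_bigr => v _ /=.
case vS: (v \in S) => //=; rewrite opp_strandK mem_comp2 // andbT jump_opp.
case: (v \in comp1 D); rewrite ?andbF //= !andbT.
case: (opp_strand v \in comp1 D); rewrite ?andbF //= ?andbT.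
case cv: (classical (kind_of D v.1)); last first.
  by rewrite /jump cv; move: cv; case: (kind_of D v.1).
rewrite is_over_opp // negbK; case: ifP => // o.
by rewrite jump_over.
Qed.

End Span.

(** * Choices of colorings and lifts *)

(** Along each component the jumps sum to the span up to sign, hence to zero modulo the span. *)
Lemma labeling_exists D : wf_vcode D ->
  exists L, labeling (link_span (gauss D)) (jump (kind_of D)) L D.
Proof.
move=> wfD; set s := link_span _; set d := jump _.
have s1 : congr_mod s (\sum_(v <- comp1 D) d v) 0.
  by rewrite /congr_mod subr0 /s link_span_jump // dvdzE absz_nat.
have s2 : congr_mod s (\sum_(v <- comp2 D) d v) 0.
  by move: s1; rewrite sum_jump12 // /congr_mod !subr0 rpredN.
have [L1 c1] := label_cycle_exists (wf_uniq1 wfD) s1.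
have [L2 c2] := label_cycle_exists (wf_uniq2 wfD) s2.
exists (fun v => if v \in comp1 D then L1 v else L2 v).
apply/andP; split.
  apply: (sub_in_cycle (P := [in comp1 D])) c1; last exact/allP.
  by move=> u v /= u1 v1; rewrite /label_step u1 v1.
apply: (sub_in_cycle (P := [in comp2 D])) c2; last exact/allP.
move=> u v /= u2 v2; rewrite /label_step.
case: ifP => [v1|_]; first by case: (wf_comp12 wfD v1 v2).
by case: ifP => // u1; case: (wf_comp12 wfD u1 u2).
Qed.

Lemma coloring_exists g A : exists lab, coloring g A lab.
Proof.
pose D (k : int) := match cover_end A k with
  | Some (c, true) => sign g c | Some (c, false) => - sign g c | None => 0 end.
(* Segment 0 gets the label 0, and the changes are summed in both directions from it; a line imposes
   no closing condition. *)
exists (fun k => match k with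
  | Posz n => \sum_(i < n) D i%:Z
  | Negz n => - \sum_(i < n.+1) D (Negz i) end).
rewrite /coloring => -[n|[|n]].
- by rewrite /= addn1 big_ord_recr.
- by rewrite /= big_ord0 big_ord1 addNr.
have -> : Negz n.+1 + 1 = Negz n by lia.
by rewrite [in RHS]big_ord_recr /= opprD addrNK.
Qed.

Lemma cover_end_index (A : seq arrow_end) e :
  e \in A -> cover_end A (index e A)%:Z = Some e.
Proof.
move=> eA; rewrite /cover_end modz_nat absz_nat modn_small ?index_mem //.
by rewrite onthE (nth_map e) ?index_mem // nth_index.
Qed.

Lemma choices_exist D : wf_vcode D -> exists C, valid_choices (gauss D) C.
Proof.
move=> wfD; set g := gauss D.
have [lab1 c1] := coloring_exists g (circle1 g).
have [lab2 c2] := coloring_exists g (circle2 g).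
(* An arrow end lies on one circle only, so one formula serves the arrows of both directions; the
   lift chosen is the one in the first period. *)
pose lift o c : int :=
  let A := if (c, o) \in circle1 g then circle1 g else circle2 g in index (c, o) A.
exists (Choices lab1 lab2 (lift true) (lift false)).
split=> // c /mem_arrows[v [<- o v1 v2]];
  rewrite /lift /= mem_gauss_tail // mem_gauss_head //.
  rewrite v1 ifN ?cover_end_index ?mem_gauss_tail ?mem_gauss_head //.
  by apply/negP => /(wf_comp12 wfD)/(_ v2).
rewrite v2 ifN ?cover_end_index ?mem_gauss_tail ?mem_gauss_head //.
by apply/negP => /(wf_comp12 wfD)/(_ v1).
Qed.

Lemma label_cycle_nth (T : eqType) s d L (K : seq T) x i :
  cycle (label_step s d L) K -> (i < size K)%N ->
  label_step s d L (nth x K i) (nth x K (i.+1 %% size K)).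
Proof.
case: K => // y K /pathP-/(_ x i); rewrite size_rcons => h lti.
have := h lti; rewrite -rcons_cons !nth_rcons lti [size (y :: K)]/=.
move: lti; rewrite ltnS leq_eqVlt => /orP[/eqP-> | ltiK].
  by rewrite ltnn eqxx modnn.
by rewrite ltiK modn_small.
Qed.

Lemma coloring_label s D L (A : seq strand) lab :
  cycle (label_step s (jump (kind_of D)) L) A ->
  coloring (gauss D) (gauss_circle (kind_of D) A) lab ->
  exists a, forall (v : strand) k, classical (kind_of D v.1) ->
    cover_end (gauss_circle (kind_of D) A) k =
      Some (v.1, is_over (kind_of D v.1) v.2) ->
    congr_mod s (lab k) (L v + a).
Proof.
set d := jump _ => cA; set K := filter (fun v : strand => classical (kind_of D v.1)) A.
have {cA} cK : cycle (label_step s d L) K.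
  by apply: filter_label_cycle cA => v; rewrite /d /jump => /negPf->.
rewrite /gauss_circle -/K => col.
case EK: K => [|x K']; first by exists 0 => v k _; rewrite /cover_end; case: absz.
rewrite -EK; have K0 : (0 < size K)%N by rewrite EK.
(* The strand that lies below the [k]-th lifted end. *)
pose pos (k : int) := nth x K (absz (k %% size K)%Z).
have lt_pos (k : int) : (absz (k %% size K)%Z < size K)%N.
  have := ltz_pmod k (d := size K); have := modz_ge0 k (d := size K); lia.
have posK (k : int) : pos k \in K by rewrite mem_nth.
have cov (k : int) : cover_end [seq (v.1, is_over (kind_of D v.1) v.2) | v <- K] k =
    Some ((pos k).1, is_over (kind_of D (pos k).1) (pos k).2).
  by rewrite /cover_end size_map onthE -map_comp (nth_map x).
have step (k : int) : congr_mod s (L (pos (k + 1))) (L (pos k) + d (pos k)).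
  have := label_cycle_nth x cK (lt_pos k); rewrite /label_step -/(pos k).
  suff -> : ((absz (k %% size K)%Z).+1 %% size K)%N = absz ((k + 1) %% size K)%Z by [].
  have s0 : (size K)%:Z != 0 by lia.
  have := modz_ge0 k s0; rewrite -[X in _ = absz X]modzDml.
  case: (k %% size K)%Z => // n _.
  by rewrite -PoszD modz_nat !absz_nat addn1.
have labS (k : int) : lab (k + 1) = lab k + d (pos k).
  rewrite col cov; congr (_ + _); have := posK k; rewrite mem_filter => /andP[c _].
  by rewrite /d jump_gauss //=; case: is_over.
exists (lab 0 - L (pos 0)).
have main (k : int) : congr_mod s (lab k) (L (pos k) + (lab 0 - L (pos 0))).
  elim: k => [|n IH|n IH].
  - by rewrite addrC subrK congr_mod_refl.
  - rewrite -addn1 PoszD labS.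
    apply: congr_mod_trans (congr_modD IH (congr_mod_refl _ _)) _.
    by rewrite addrAC congr_modDr congr_mod_sym.
  have e : (- n%:Z) = - n.+1%:Z + 1 by lia.
  rewrite -(congr_modDr _ (d (pos (- n.+1%:Z)))) -labS -e addrAC.
  apply: congr_mod_trans IH _; rewrite congr_modDr e; exact: step.
move=> v k cv; rewrite cov => -[e1 e2]; have := main k.
suff -> : pos k = v by [].
exact: esym (is_over_inj cv (esym e1) (esym e2)).
Qed.

(** * The linking polynomial of a labeling of the strands *)

Section LinkSum.
Variables (D : vcode) (L : strand -> int).

(** For an over strand [v] the label just after the tail is [L v] plus the sign, so the exponent is
    N(c) before reduction. *)
Definition link_term (v : strand) : ratfun :=
  (kind_sign (kind_of D v.1))%:~R *
  tvar ^ (L (opp_strand v) - L v - kind_sign (kind_of D v.1)).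

Definition link_sum (A B : seq strand) : ratfun :=
  \sum_(v <- strands D | (v \in A) &&
      (is_over (kind_of D v.1) v.2 && (opp_strand v \in B))) link_term v.

Lemma laurent_link_term v : laurent (link_term v).
Proof. by apply: laurentM; [exact: laurent_int | exact: laurent_exp]. Qed.

Lemma laurent_link_sum A B : laurent (link_sum A B).
Proof. by apply: laurent_sum => v _; apply: laurent_link_term. Qed.

Definition strand_polynomial : ratfun :=
  link_sum (comp1 D) (comp2 D) * link_sum (comp2 D) (comp1 D).

End LinkSum.

(** The constants [a] and [b] by which the colorings differ from [L] add b - a to every exponent. *)
Lemma link_sum_choices D C L A B labA labB a b :
  let s := link_span (gauss D) in
  let circle := gauss_circle (kind_of D) in
  valid_lifts (circle A) (circle B) C ->
  coloring (gauss D) (circle A) labA ->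
  (forall (v : strand) k, classical (kind_of D v.1) ->
    cover_end (circle A) k = Some (v.1, is_over (kind_of D v.1) v.2) ->
    congr_mod s (labA k) (L v + a)) ->
  (forall (v : strand) k, classical (kind_of D v.1) ->
    cover_end (circle B) k = Some (v.1, is_over (kind_of D v.1) v.2) ->
    congr_mod s (labB k) (L v + b)) ->
  laurent_eqmod s
    (\sum_(c <- arrows (circle A) (circle B))
       (sign (gauss D) c)%:~R * tvar ^ arrow_index (gauss D) C labA labB c)
    (tvar ^ (b - a) *
     \sum_(v <- A | is_over (kind_of D v.1) v.2 && (opp_strand v \in B))
       link_term D L v).
Proof.
move=> s circle lifts colA hA hB; rewrite big_arrows big_distrr /=.
apply: laurent_eqmod_sum => v vA /andP[o vB]; rewrite /link_term mulrCA.
apply: laurent_eqmodMl; first exact: laurent_int.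
rewrite -expfzDr ?tvar_neq0 //; apply: laurent_eqmod_exp.
apply: congr_mod_trans (congr_mod_modz _ _) _.
have cv := is_over_classical o.
have [t h] : cover_end (circle A) (tail_lift C v.1) = Some (v.1, true) /\
    cover_end (circle B) (head_lift C v.1) = Some (v.1, false).
  apply: lifts; apply/mapP; exists (v.1, true) => //.
  by rewrite mem_filter /= mem_gauss_head // vB mem_gauss_tail.
(* The rule of the coloring at the tail turns the label after it into the label before it plus the
   sign. *)
rewrite colA t /=.
have := congr_modB (hB (opp_strand v) (head_lift C v.1) _ _)
  (congr_modD (hA v (tail_lift C v.1) cv _)
     (congr_mod_refl s (kind_sign (kind_of D v.1)))).
rewrite /= is_over_opp // o => /(_ cv h t).
by congr (congr_mod s _ _); ring.
Qed.

Lemma linking_polynomial_strands D C L : wf_vcode D ->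
  let s := link_span (gauss D) in
  valid_choices (gauss D) C -> labeling s (jump (kind_of D)) L D ->
  laurent_eqmod s (linking_polynomial D C) (strand_polynomial D L).
Proof.
move=> wfD s [col1 col2 l12 l21] /andP[lab1 lab2].
have [a h1] := coloring_label lab1 col1; have [b h2] := coloring_label lab2 col2.
have F := link_sum_choices l12 col1 h1 h2; have G := link_sum_choices l21 col2 h2 h1.
(* The factors t^(b - a) and t^(a - b) are inserted; their product is 1. *)
have -> : strand_polynomial D L =
    (tvar ^ (b - a) * link_sum D L (comp1 D) (comp2 D)) *
    (tvar ^ (a - b) * link_sum D L (comp2 D) (comp1 D)).
  rewrite mulrACA -expfzDr ?tvar_neq0 //.
  by have -> : b - a + (a - b) = 0 by [ring]; rewrite mul1r.
apply: laurent_eqmodM.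
- by apply: laurentM; [exact: laurent_exp | exact: laurent_link_sum].
- apply: laurent_sum => c _.
  by apply: laurentM; [exact: laurent_int | exact: laurent_exp].
- by rewrite /link_sum -sum_comp1.
by rewrite /link_sum -sum_comp2.
Qed.

(** One pair of labelings is enough, since every labeling computes the linking polynomial. *)
Definition same_invariant (D D' : vcode) : Prop :=
  let s := link_span (gauss D) in
  s = link_span (gauss D') /\
  exists L L', [/\ labeling s (jump (kind_of D)) L D,
    labeling s (jump (kind_of D')) L' D'
    & laurent_eqmod s (strand_polynomial D L) (strand_polynomial D' L')].

(** * The first and second moves *)

(** Common form of the first two moves. The erased strands form adjacent pairs with cancelling
    jumps, so these jumps can be set to zero and the strands filtered out. The last hypothesis
    removes the erased crossings from both sums. *)
Lemma erase_invariant D (xs : seq nat) (bs : seq (strand * strand)) :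
  wf_vcode D -> wf_vcode (erase xs D) ->
  {in bs, forall b : strand * strand, adjacent D b.1 b.2} ->
  {in bs, forall b : strand * strand, b.1 \notin unzip2 bs} ->
  {in bs, forall b : strand * strand,
     jump (kind_of D) b.1 + jump (kind_of D) b.2 = 0} ->
  (forall v : strand, (v.1 \in xs) = (v \in unzip1 bs) || (v \in unzip2 bs)) ->
  (forall L, labeling (link_span (gauss D)) (jump (kind_of D)) L D ->
     forall A B,
       A = comp1 D /\ B = comp2 D \/ A = comp2 D /\ B = comp1 D ->
     laurent_eqmod (link_span (gauss D))
       (\sum_(v <- [seq v <- strands D | v.1 \in xs] | (v \in A) &&
           (is_over (kind_of D v.1) v.2 && (opp_strand v \in B)))
         link_term D L v) 0) ->
  same_invariant (erase xs D) D.
Proof.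
set D0 := erase xs D; set d := jump _ => wfD wfD0 adj disj sum cover cancel.
pose e (v : strand) := if v.1 \in xs then 0 else d v.
have inxs1 b : b \in bs -> b.1.1 \in xs by move=> bbs; rewrite cover map_f.
have inxs2 b : b \in bs -> b.2.1 \in xs by move=> bbs; rewrite cover map_f ?orbT.
have esum : {in bs, forall b : strand * strand, e b.1 + e b.2 = d b.1 + d b.2}.
  by move=> b bbs; rewrite /e inxs1 // inxs2 // addr0 sum.
have eout v : v \notin unzip1 bs -> v \notin unzip2 bs -> e v = d v.
  by move=> v1 v2; rewrite /e cover (negPf v1) (negPf v2).
have span : link_span (gauss D0) = link_span (gauss D).
  rewrite !link_span_jump //; congr absz.
  rewrite -(sum_shift1 wfD adj disj esum eout) big_filter big_mkcond /=.
  by apply: eq_bigr => v _; rewrite /e; case: (v.1 \in xs).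
rewrite /same_invariant span; split=> //.
have [L labL] := labeling_exists wfD; set s := link_span _ in labL *.
pose sh := shift d e bs.
(* The labels change only at erased strands, so the terms of the surviving crossings stay the
   same. *)
have sh0 v : v.1 \notin xs -> sh v = 0.
  by rewrite cover negb_or /sh /shift => /andP[_ /negPf->].
exists (fun v => L v + sh v), L; split=> //.
  have /andP[c1 c2] := labeling_shift wfD adj disj esum eout labL.
  have filt K : cycle (label_step s e (fun v => L v + sh v)) K ->
      cycle (label_step s d (fun v => L v + sh v)) [seq v <- K | v.1 \notin xs].
    move/(filter_label_cycle (p := fun v : strand => v.1 \notin xs)) => h.
    apply: (sub_in_cycle (P := fun v : strand => v.1 \notin xs)) (h _).
    - by move=> u v /= /negPf u0 _; rewrite /label_step /e u0.
    - exact: filter_all.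
    by move=> v /negPn; rewrite /e => ->.
  by rewrite /labeling !filt.
have part A B : A = comp1 D /\ B = comp2 D \/ A = comp2 D /\ B = comp1 D ->
    laurent_eqmod s
      (link_sum D0 (fun v => L v + sh v) [seq v <- A | v.1 \notin xs]
                                         [seq v <- B | v.1 \notin xs])
      (link_sum D L A B).
  move=> AB; rewrite [X in laurent_eqmod _ _ X](bigID (fun v : strand => v.1 \in xs)) /=.
  rewrite -[X in laurent_eqmod _ X _]add0r; apply: laurent_eqmodD.
    apply: laurent_eqmod_sym; move: (cancel L labL A B AB).
    by rewrite big_filter_cond; under eq_bigl do rewrite andbC.
  rewrite /link_sum /strands -filter_cat big_filter_cond.
  under [X in laurent_eqmod _ _ X]eq_bigl do rewrite andbC.
  under eq_bigl => v do rewrite !mem_filter /=.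
  rewrite (eq_bigl (fun v : strand => (v.1 \notin xs) && ((v \in A) &&
    (is_over (kind_of D v.1) v.2 && (opp_strand v \in B))))); last first.
    by move=> v; case: (v.1 \in xs).
  rewrite (eq_bigr (link_term D L)); first exact: laurent_eqmod_refl.
  by move=> v /andP[vx _]; rewrite /link_term /= !sh0 // !addr0.
apply: laurent_eqmodM; try exact: laurent_link_sum.
  by apply: part; left.
by apply: part; right.
Qed.

(** The two strands of the loop are adjacent, with opposite jumps. They lie on one component, so the
    crossing occurs in neither F nor G. *)
Lemma move1_invariant (D D' : vdiagram) : move1 D D' -> same_invariant D D'.
Proof.
case: D D' => [D wfD _] [D' wfD' _] /= [x [b [adj eD]]].
rewrite eD in wfD *.
apply: (erase_invariant (bs := [:: ((x, b), (x, ~~ b))])) => //.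
- by move=> p; rewrite inE => /eqP->.
- by move=> p; rewrite inE => /eqP->; rewrite inE xpair_eqE eqxx; case: b {adj}.
- move=> p; rewrite inE => /eqP-> /=.
  by rewrite -[(x, ~~ b)]/(opp_strand (x, b)) jump_opp subrr.
- move=> [z c]; rewrite !inE !xpair_eqE; case: (z == x) => //=.
  by case: b c {adj} => [] [].
move=> L _ A B AB; rewrite big_filter_cond big1_seq; first exact: laurent_eqmod_refl.
case=> z c /andP[/and4P[]]; rewrite inE => /eqP/=-> vA _ vB _.
have same : (x, c) \in A -> (x, ~~ c) \in A.
  have [c1 c2] := (adjacent_comp1 wfD' adj, adjacent_comp2 wfD' adj).
  case: AB => -[-> _]; first by case: b c {adj vA vB} c1 c2 => [] [] /= ->.
  by case: b c {adj vA vB} c1 c2 => [] [] /= _ ->.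
case: AB (same vA) vB => -[-> ->] v1 v2; first by case: (wf_comp12 wfD' v1 v2).
by case: (wf_comp12 wfD' v2 v1).
Qed.

(* On the two sides of a two-edged face the labels change by opposite amounts
   between the crossings, so both crossings have the same index. *)
Lemma link_term_cancel D s L (u w : strand) :
  is_over (kind_of D u.1) u.2 ->
  kind_sign (kind_of D w.1) = - kind_sign (kind_of D u.1) ->
  congr_mod s (L w) (L u + jump (kind_of D) u) ->
  congr_mod s (L (opp_strand w)) (L (opp_strand u) - jump (kind_of D) u) ->
  laurent_eqmod s (link_term D L u + link_term D L w) 0.
Proof.
move=> o sw; rewrite jump_over // /link_term sw => h h'.
rewrite intrN mulNr -mulrBr.
rewrite -[X in laurent_eqmod _ _ X](mulr0 (kind_sign (kind_of D u.1))%:~R).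
apply: laurent_eqmodMl; first exact: laurent_int.
rewrite -[X in laurent_eqmod _ _ X](subrr (tvar ^ (L (opp_strand u) - L u -
  kind_sign (kind_of D u.1)))).
apply: laurent_eqmodD; first exact: laurent_eqmod_refl.
rewrite -![- tvar ^ _]mulN1r; apply: laurent_eqmodMl.
  exact: (laurent_int (- 1)).
apply: laurent_eqmod_exp; rewrite opprK.
have := congr_modD (congr_modB h' h) (congr_mod_refl s (kind_sign (kind_of D u.1))).
by congr (congr_mod s _ _); ring.
Qed.

Lemma move2_invariant (D D' : vdiagram) : move2 D D' -> same_invariant D D'.
Proof.
case: D D' => [D wfD _] [D' wfD' _] /= [x [y [b [nxy adj1 adj2 kinds eD]]]].
rewrite eD in wfD * => {D eD}.
(* The strands [u], [w] follow each other on one side of the bigon; their opposites lie on the other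
   side, in either order. *)
pose u : strand := (x, b); pose w : strand := (y, ~~ b).
have ou : opp_strand u = (x, ~~ b) by [].
have ow : opp_strand w = (y, b) by rewrite /opp_strand /= negbK.
rewrite -ou -ow -/u -/w in adj1 adj2.
have jw : jump (kind_of D') w = - jump (kind_of D') u.
  move: kinds; rewrite /jump /=; case: (kind_of D' x); case: (kind_of D' y) => //= _;
    by case: b {u w adj1 adj2 ou ow}; rewrite ?opprK ?oppr0.
have sw : kind_sign (kind_of D' w.1) = - kind_sign (kind_of D' u.1).
  by move: kinds; case: (kind_of D' x); case: (kind_of D' y).
have over_uw : is_over (kind_of D' w.1) w.2 = is_over (kind_of D' u.1) u.2.
  by move: kinds => /=; case: (kind_of D' x); case: (kind_of D' y); rewrite //= negbK.
have over_opp : is_over (kind_of D' w.1) (~~ w.2) = is_over (kind_of D' u.1) (~~ u.2).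
  by move: kinds => /=; case: (kind_of D' x); case: (kind_of D' y); rewrite //= !negbK.
have same_comp A B : A = comp1 D' /\ B = comp2 D' \/ A = comp2 D' /\ B = comp1 D' ->
    [/\ (w \in A) = (u \in A), (opp_strand w \in A) = (opp_strand u \in A),
        (w \in B) = (u \in B) & (opp_strand w \in B) = (opp_strand u \in B)].
  move=> AB.
  have [d1 d2] : (opp_strand w \in comp1 D') = (opp_strand u \in comp1 D') /\
      (opp_strand w \in comp2 D') = (opp_strand u \in comp2 D').
    by case: adj2 => h; rewrite (adjacent_comp1 wfD' h) (adjacent_comp2 wfD' h).
  have c1 := adjacent_comp1 wfD' adj1; have c2 := adjacent_comp2 wfD' adj1.
  by case: AB => -[-> ->].
(* The pair [p] is the second side in its order of travel, for parallel or antiparallel sides. *)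
have [p [pE adjp]] : exists p, (p = (opp_strand u, opp_strand w) \/
    p = (opp_strand w, opp_strand u)) /\ adjacent D' p.1 p.2.
  case: adj2 => h; first by exists (opp_strand u, opp_strand w); split=> //; left.
  by exists (opp_strand w, opp_strand u); split=> //; right.
have nyx : y != x by rewrite eq_sym.
apply: (erase_invariant (bs := [:: (u, w); p])) => //.
- by move=> q; rewrite !inE => /orP[] /eqP->.
- move=> q; rewrite !inE => /orP[] /eqP->; case: pE => pE;
    by rewrite ?pE ou ow !xpair_eqE /= ?eqxx ?(negPf nxy) ?(negPf nyx) /=; case: (b).
- move=> q; rewrite !inE => /orP[] /eqP->; case: pE => pE; rewrite ?pE;
    by rewrite ![fst _]/= ![snd _]/= ?jump_opp ?jump_opp jw; lia.
- move=> [z c]; rewrite !inE; case: pE => ->; rewrite ou ow !xpair_eqE /=;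
    by case: (z == x); case: (z == y); case: (b); case: (c).
move=> L lab A B AB; set S := filter _ _.
have perm : perm_eq S [:: u; w; opp_strand u; opp_strand w].
  have [uD wD] := adjacent_mem adj1.
  apply: uniq_perm; first by rewrite filter_uniq // wf_uniq.
    rewrite ou ow /u /w /= !inE !xpair_eqE ?(negPf nxy) ?(negPf nyx) /=.
    by rewrite !eqxx; case: (b).
  have memD v : v \in [:: u; w; opp_strand u; opp_strand w] -> v \in strands D'.
    by rewrite !inE => /or4P[] /eqP->; rewrite ?wf_opp.
  move=> v; apply/idP/idP => [|vM]; last first.
    rewrite mem_filter memD // andbT; move: vM; rewrite ou ow !inE.
    by case/or4P=> /eqP-> /=; rewrite eqxx ?orbT.
  rewrite mem_filter => /andP[]; rewrite ou ow /u /w; case: v => z c.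
  rewrite !inE !xpair_eqE /= => /orP[] /eqP-> _; rewrite eqxx;
    by case: (b); case: (c); rewrite ?orbT.
rewrite (perm_big _ perm) /= !big_cons big_nil addr0.
have step := labelingP _ _ _ wfD' lab.
have stepa v v' : adjacent D' v v' ->
    congr_mod (link_span (gauss D')) (L v') (L v + jump (kind_of D') v).
  by move=> /andP[vD /eqP<-]; apply: step.
have hw := stepa _ _ adj1.
(* Both orientations of the second side give the same relation, because [jump] changes sign between
   the two crossings. *)
have how : congr_mod (link_span (gauss D'))
    (L (opp_strand w)) (L (opp_strand u) - jump (kind_of D') u).
  case: adj2 => /stepa; rewrite jump_opp // jw opprK => h.
  by rewrite congr_mod_sym -(congr_modDr _ (jump (kind_of D') u)) subrK.
(* The conditions at [w] and its opposite reduce to those at [u] and its opposite, so the terms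
   occur in cancelling pairs. *)
have [m1 m2 m3 m4] := same_comp A B AB.
rewrite !opp_strandK m1 m2 m3 m4 over_uw over_opp.
set s := link_span _ in hw how *.
have cancel1 : is_over (kind_of D' u.1) u.2 ->
    laurent_eqmod s (link_term D' L u + link_term D' L w) 0.
  by move=> o; apply: link_term_cancel.
have cancel2 : is_over (kind_of D' u.1) (~~ u.2) ->
    laurent_eqmod s (link_term D' L (opp_strand u) + link_term D' L (opp_strand w)) 0.
  move=> o; apply: link_term_cancel; rewrite // ?opp_strandK jump_opp ?opprK //.
have zero := laurent_eqmod_refl s 0.
case: (boolP (_ && _)) => [/and3P[_ /cancel1 h1 _] | _];
  case: (boolP (_ && _)) => [/and3P[_ /cancel2 h2 _] | _]; rewrite ?addr0 //.
by rewrite addrA -[X in laurent_eqmod _ _ X]addr0; apply: laurent_eqmodD.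
Qed.

(** * The third moves *)

(** The change of the label at [v] when the strands of each side are exchanged: a first strand now
    comes after [fl v] and gains its jump, a second strand now comes before [fl v] and loses it. *)
Definition flip_shift (kd : nat -> kind) (bs : seq (strand * strand))
    (fl : strand -> strand) (v : strand) : int :=
  if v \in unzip1 bs then jump kd (fl v)
  else if v \in unzip2 bs then - jump kd (fl v) else 0.

(** Common form of the third moves: [fl] exchanges the two strands of each pair. By the last
    hypothesis the labels at both strands of a classical crossing change equally, so every index is
    kept. *)
Lemma flip_invariant D (fl : strand -> strand) (bs : seq (strand * strand)) :
  let D' := VCode (map fl (comp1 D)) (map fl (comp2 D)) (kind_of D) in
  wf_vcode D -> wf_vcode D' -> involutive fl ->
  {in bs, forall b : strand * strand, adjacent D b.1 b.2} ->
  {in bs, forall b : strand * strand, b.1 \notin unzip2 bs} ->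
  {in bs, forall b : strand * strand, fl b.1 = b.2} ->
  (forall v : strand, v \notin unzip1 bs -> v \notin unzip2 bs -> fl v = v) ->
  (forall v : strand, is_over (kind_of D v.1) v.2 ->
     flip_shift (kind_of D) bs fl v = flip_shift (kind_of D) bs fl (opp_strand v)) ->
  same_invariant D D'.
Proof.
move=> D' wfD wfD' flK adj disj flE flout shE; set d := jump (kind_of D).
(* The new code carries [fl v] at the place of [v], so [e] is the new jump function read at the old
   places. *)
pose e v := d (fl v).
have flE' b : b \in bs -> fl b.2 = b.1 by move=> bbs; rewrite -flE.
have esum : {in bs, forall b : strand * strand, e b.1 + e b.2 = d b.1 + d b.2}.
  by move=> b bbs; rewrite /e flE // flE' // addrC.
have eout v : v \notin unzip1 bs -> v \notin unzip2 bs -> e v = d v.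
  by move=> v1 v2; rewrite /e flout.
have fl_comp A : A = comp1 D \/ A = comp2 D -> forall v, (fl v \in A) = (v \in A).
  move=> AE v; have same b : b \in bs -> (b.1 \in A) = (b.2 \in A).
    move=> /adj ab; case: AE => ->; first exact: adjacent_comp1 ab.
    exact: adjacent_comp2 ab.
  case v1: (v \in unzip1 bs).
    have {v1} /mapP[b bbs ->] := v1; rewrite flE //.
    by rewrite same.
  case v2: (v \in unzip2 bs); last by rewrite flout ?v1 ?v2.
  have {v1 v2} /mapP[b bbs ->] := v2; rewrite flE' //.
  by rewrite same.
have mem_fl A : A = comp1 D \/ A = comp2 D -> map fl A =i A.
  move=> AE v; rewrite -{1}[v]flK mem_map; last exact: inv_inj flK.
  exact: fl_comp.
have perm1 : perm_eq (map fl (comp1 D)) (comp1 D).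
  by apply: uniq_perm; [exact: (wf_uniq1 wfD') | exact: wf_uniq1 | apply: mem_fl; left].
have perm2 : perm_eq (map fl (comp2 D)) (comp2 D).
  by apply: uniq_perm; [exact: (wf_uniq2 wfD') | exact: wf_uniq2 | apply: mem_fl; right].
have span : link_span (gauss D) = link_span (gauss D').
  by rewrite !link_span_jump //= (perm_big _ perm1).
rewrite /same_invariant; split=> //.
have [L lab] := labeling_exists wfD; set s := link_span _ in lab *.
(* The place of [v] in the new code was that of [fl v]; the shifted labeling is transported along
   this correspondence. *)
pose sh := shift d e bs; pose L' v := L (fl v) + sh (fl v).
exists L, L'; split=> //.
  have /andP[c1 c2] := labeling_shift wfD adj disj esum eout lab.
  have flip K : cycle (label_step s e (fun v => L v + sh v)) K ->
      cycle (label_step s d L') (map fl K).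
    rewrite cycle_map; apply: sub_cycle => u v /=.
    by rewrite /label_step /L' !flK.
  by rewrite /labeling /= !flip.
have step u v : adjacent D u v -> congr_mod s (L v) (L u + d u).
  by move=> /andP[uD /eqP<-]; apply: (labelingP _ _ _ wfD lab).
have moved v : congr_mod s (L' v) (L v + flip_shift (kind_of D) bs fl v).
  rewrite /L' /flip_shift /sh; case v1: (v \in unzip1 bs).
    have {v1} /mapP[b bbs ->] := v1; rewrite flE // /shift map_f // /e flE' // addrA -/d.
    rewrite -(congr_modDr _ (d b.1)) subrK addrAC congr_modDr.
    by apply: step; apply: adj.
  case v2: (v \in unzip2 bs).
    have {v1 v2} /mapP[b bbs ->] := v2.
    rewrite flE' // /shift (negPf (disj b bbs)) addr0 -/d.
    rewrite -(congr_modDr _ (d b.1)) subrK congr_mod_sym.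
    by apply: step; apply: adj.
  by rewrite flout ?v1 ?v2 // /shift v2 congr_mod_refl.
have part A B : A = comp1 D \/ A = comp2 D -> B = comp1 D \/ B = comp2 D ->
    laurent_eqmod s (link_sum D L A B) (link_sum D' L' (map fl A) (map fl B)).
  move=> AE BE; rewrite /link_sum.
  rewrite [X in laurent_eqmod _ _ X](perm_big (strands D)); last exact: perm_cat.
  under [X in laurent_eqmod _ _ X]eq_bigl do rewrite !mem_fl //.
  apply: laurent_eqmod_sum => v vD /and3P[_ o _]; rewrite /link_term /=.
  apply: laurent_eqmodMl; first exact: laurent_int.
  apply: laurent_eqmod_exp; rewrite congr_modDr congr_mod_sym.
  have := congr_modB (moved (opp_strand v)) (moved v).
  by rewrite -(shE v o); congr (congr_mod s _ _); ring.
apply: laurent_eqmodM; try exact: laurent_link_sum.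
  by apply: part; [left | right].
by apply: part; [right | left].
Qed.

Section Triangle.
Variables (x y z : nat) (i j k : bool).
Hypothesis xyz : uniq [:: x; y; z].
Local Notation fl := (flip_triangle x y z i j k).

Lemma triangle_neq :
  ((x == y) = false) * ((x == z) = false) * ((y == z) = false) *
  (((y == x) = false) * ((z == x) = false) * ((z == y) = false)).
Proof.
move: xyz; rewrite /= !inE negb_or andbT => /andP[/andP[xy xz] yz].
have neq := (negPf xy, negPf xz, negPf yz).
by do !split; rewrite ?neq // eq_sym neq.
Qed.

Lemma flip_triangle_out v : v.1 \notin [:: x; y; z] -> fl v = v.
Proof.
case: v => w c; rewrite !inE !negb_or => /and3P[wx wy wz].
by rewrite /flip_triangle /= !xpair_eqE (negPf wx) (negPf wy) (negPf wz).
Qed.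

Lemma flip_triangleE :
  [/\ fl (x, i) = (z, ~~ k), fl (z, ~~ k) = (x, i), fl (y, j) = (x, ~~ i),
      fl (x, ~~ i) = (y, j) & fl (z, k) = (y, ~~ j) /\ fl (y, ~~ j) = (z, k)].
Proof.
have neq := triangle_neq.
rewrite /flip_triangle /= !xpair_eqE !neq !eqxx /=.
by case: (i); case: (j); case: (k).
Qed.

Lemma triangle_strand (v : strand) : v.1 \in [:: x; y; z] ->
  [\/ v = (x, i) \/ v = (x, ~~ i), v = (y, j) \/ v = (y, ~~ j)
    | v = (z, k) \/ v = (z, ~~ k)].
Proof.
have two (a b : bool) : a = b \/ a = ~~ b by case: a b => [] []; tauto.
case: v => w c; rewrite !inE => /or3P[] /eqP /= ->.
- by apply: Or31; case: (two c i) => ->; tauto.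
- by apply: Or32; case: (two c j) => ->; tauto.
by apply: Or33; case: (two c k) => ->; tauto.
Qed.

Lemma flip_triangleK : involutive fl.
Proof.
move=> v; have [e1 e2 e3 e4 [e5 e6]] := flip_triangleE.
case vT: (v.1 \in [:: x; y; z]); last by rewrite !flip_triangle_out ?vT.
by case: (triangle_strand vT) => -[] ->; rewrite ?(e1, e2, e3, e4, e5, e6).
Qed.

(** Each side lists its strands in the order of travel, as fixed in [triangle]. *)
Definition triangle_sides s : seq (strand * strand) :=
  let side (first : bool) (u v : strand) := if first then (u, v) else (v, u) in
  [:: side (s (+) j) (x, i) (z, ~~ k); side (s (+) k) (y, j) (x, ~~ i);
      side (s (+) i) (z, k) (y, ~~ j)].

Lemma triangle_sides_mem s v :
  v.1 \notin [:: x; y; z] ->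
  v \notin unzip1 (triangle_sides s) /\ v \notin unzip2 (triangle_sides s).
Proof.
case: v => w c; rewrite !inE !negb_or => /and3P[/negPf wx /negPf wy /negPf wz].
rewrite /triangle_sides; case: (s (+) j); case: (s (+) k); case: (s (+) i);
  by split; rewrite /= ?inE !xpair_eqE !(wx, wy, wz).
Qed.

(** If all three crossings are classical, both strands at [x] shift by (-1)^(s + j + k), and
    similarly at [y] and [z]. If only one is classical, its strands do not shift, as the neighbours
    on the sides are virtual. *)
Lemma triangle_shift D s (v : strand) : triangle_kinds D x y z i j k ->
  is_over (kind_of D v.1) v.2 ->
  flip_shift (kind_of D) (triangle_sides s) fl v =
  flip_shift (kind_of D) (triangle_sides s) fl (opp_strand v).
Proof.
have [e1 e2 e3 e4 [e5 e6]] := flip_triangleE => kinds o.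
case vT: (v.1 \in [:: x; y; z]); last first.
  have [v1 v2] := triangle_sides_mem s (negbT vT).
  have [w1 w2] := @triangle_sides_mem s (opp_strand v) (negbT vT).
  by rewrite /flip_shift (negPf v1) (negPf v2) (negPf w1) (negPf w2).
pose cl c := classical (kind_of D c).
have [cx cy cz] : [/\ cl x -> cl y = cl z, cl y -> cl z = cl x & cl z -> cl x = cl y].
  move: kinds; rewrite /triangle_kinds /cl.
  by case: (kind_of D x); case: (kind_of D y); case: (kind_of D z).
rewrite /cl in cx cy cz; have cv := is_over_classical o => {o kinds}.
have oppE a b : opp_strand (a, b) = (a, ~~ b) by [].
(* The claim is symmetric in [v] and its opposite, so one strand of each crossing is enough. *)
wlog : v vT cv / v \in [:: (x, i); (y, j); (z, k)].
  move=> wl; case: (triangle_strand vT) => -[] vE;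
    try (by apply: wl; rewrite // vE !inE eqxx ?orbT);
    symmetry; rewrite -[in RHS](opp_strandK v); apply: wl => //;
    by rewrite vE oppE negbK !inE eqxx ?orbT.
have neq := triangle_neq.
have nb (b : bool) : ((b == ~~ b) = false) * ((~~ b == b) = false) by case: b.
rewrite /flip_shift /triangle_sides !inE => /or3P[] /eqP vE; rewrite vE /= in cv *;
  rewrite oppE /= ?(e1, e2, e3, e4, e5, e6) /jump /= ?(cx cv) ?(cy cv) ?(cz cv).
all: case: (s) (i) (j) (k) => [] [] [] [];
  rewrite /= ?inE !xpair_eqE /= ?eqxx ?neq ?nb /=; by case: classical.
Qed.

End Triangle.

Lemma move3_invariant (D D' : vdiagram) : move3 D D' -> same_invariant D D'.
Proof.
case: D D' => [D wfD _] [D' wfD' _] /= [x [y [z [i [j [k []]]]]]].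
move=> xyz [s [tA tB tC]] kinds eD.
rewrite eD in wfD' * => {D' eD}.
have [e1 e2 e3 e4 [e5 e6]] := flip_triangleE i j k xyz.
apply: (flip_invariant (bs := triangle_sides x y z i j k s)) => //.
- exact: flip_triangleK.
- move=> b; rewrite !inE => /or3P[] /eqP->.
  + by move: tA; case: (s (+) j).
  + by move: tB; case: (s (+) k).
  by move: tC; case: (s (+) i).
- have neq := triangle_neq xyz.
  have nb (b : bool) : ((b == ~~ b) = false) * ((~~ b == b) = false) by case: b.
  move=> b; rewrite /triangle_sides; case: (s (+) j); case: (s (+) k); case: (s (+) i);
    rewrite !inE => /or3P[] /eqP->;
    by rewrite /= ?inE !xpair_eqE ?neq ?nb ?andbF ?eqxx.
- move=> b; rewrite /triangle_sides; case: (s (+) j); case: (s (+) k); case: (s (+) i);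
    rewrite !inE => /or3P[] /eqP->;
    by rewrite /= ?(e1, e2, e3, e4, e5, e6).
- move=> v v1 v2; case vT: (v.1 \in [:: x; y; z]); last by rewrite flip_triangle_out ?vT.
  set sides := triangle_sides x y z i j k s in v1 v2.
  suff : (v \in unzip1 sides) || (v \in unzip2 sides).
    by rewrite (negPf v1) (negPf v2).
  rewrite /sides /triangle_sides; case: (triangle_strand i j k vT) => -[] ->;
    case: (s (+) j); case: (s (+) k); case: (s (+) i);
    by rewrite /= ?inE !eqxx ?orbT.
by move=> v o; apply: triangle_shift.
Qed.

(** * Base points, crossing names and the order of the components *)

(** A labeling is pulled back along the renaming. An exchange of the components exchanges F and G,
    which leaves the product unchanged. *)
Lemma same_diagram_invariant (D D' : vdiagram) :
  same_diagram D D' -> same_invariant D D'.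
Proof.
case: D D' => [D wfD _] [D' wfD' _] /= [f [n1 [n2 [f_inj kindE compE]]]].
pose rn (v : strand) : strand := (f v.1, v.2).
rewrite -/rn in compE.
have rn_inj : injective rn by move=> [x b] [y c] [/f_inj-> ->].
have rn_opp v : opp_strand (rn v) = rn (opp_strand v) by [].
have jumpE v : v \in strands D -> jump (kind_of D') (rn v) = jump (kind_of D) v.
  by move=> vD; rewrite /jump /= kindE.
have permS : perm_eq (strands D') (map rn (strands D)).
  rewrite /strands map_cat; case: compE => -[-> ->];
    last rewrite perm_sym perm_catC perm_sym;
    by apply: perm_cat; rewrite perm_rot.
have sum_rot n A : {subset A <= strands D} ->
    \sum_(v <- rot n (map rn A)) jump (kind_of D') v = \sum_(v <- A) jump (kind_of D) v.
  move=> AD; rewrite (perm_big (map rn A)) ?perm_rot //= big_map.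
  by apply: eq_big_seq => v /AD /jumpE.
have sub1 : {subset comp1 D <= strands D} by move=> v v1; rewrite mem_cat v1.
have sub2 : {subset comp2 D <= strands D} by move=> v v2; rewrite mem_cat v2 orbT.
have span : link_span (gauss D) = link_span (gauss D').
  rewrite !link_span_jump //; case: compE => -[-> _]; rewrite sum_rot //.
  (* Exchanged components change the sign of the sum of jumps, and the span is its absolute
     value. *)
  by rewrite sum_jump12 // abszN.
rewrite /same_invariant; split=> //.
have [L' lab'] := labeling_exists wfD'; rewrite -span in lab'.
set s := link_span _ in lab' *; pose L v := L' (rn v); exists L, L'.
have cyc n A : {subset A <= strands D} ->
    cycle (label_step s (jump (kind_of D')) L') (rot n (map rn A)) ->
    cycle (label_step s (jump (kind_of D)) L) A.
  move=> AD; rewrite rot_cycle cycle_map.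
  apply: (sub_in_cycle (P := [in A])); last exact/allP.
  by move=> u v /= uA _; rewrite /label_step /= jumpE // AD.
have sums n m A B : {subset A <= strands D} ->
    link_sum D' L' (rot n (map rn A)) (rot m (map rn B)) = link_sum D L A B.
  move=> AD; rewrite /link_sum (perm_big _ permS) /= big_map.
  rewrite big_seq_cond [RHS]big_seq_cond.
  apply: eq_big => [v | v /and4P[vD _ _ _]].
    case vD: (v \in strands D) => //=.
    by rewrite rn_opp !mem_rot !(mem_map rn_inj) kindE.
  by rewrite /link_term /= kindE.
split=> //.
  move: lab'; rewrite /labeling; case: compE => -[-> ->] /andP[h1 h2].
    by rewrite (cyc _ _ sub1 h1) (cyc _ _ sub2 h2).
  by rewrite (cyc _ _ sub2 h1) (cyc _ _ sub1 h2).
have -> : strand_polynomial D' L' = strand_polynomial D L; last exact: laurent_eqmod_refl.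
rewrite /strand_polynomial; case: compE => -[-> ->]; rewrite !sums //.
exact: mulrC.
Qed.

(** * Invariance of the linking polynomial *)

Definition same_linking (D D' : vdiagram) : Prop :=
  link_span (gauss D) = link_span (gauss D') /\
  (forall C C' : choices,
     valid_choices (gauss D) C -> valid_choices (gauss D') C' ->
     laurent_eqmod (link_span (gauss D))
       (linking_polynomial D C) (linking_polynomial D' C')).

Lemma wf_vdiagram (D : vdiagram) : wf_vcode D.
Proof. by case: D. Qed.

Lemma same_invariant_linking (D D' : vdiagram) :
  same_invariant D D' -> same_linking D D'.
Proof.
move=> [e [L [L' [lab lab' h]]]]; split=> // C C' vC vC'.
apply: laurent_eqmod_trans (linking_polynomial_strands (wf_vdiagram D) vC lab) _.
apply: laurent_eqmod_trans h _; apply: laurent_eqmod_sym.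
by rewrite e in lab' *; apply: linking_polynomial_strands vC' lab'; apply: wf_vdiagram.
Qed.

Lemma vlink_equiv_linking (D D' : vdiagram) : vlink_equiv D D' -> same_linking D D'.
Proof.
elim=> {D D'} [D D' m | D D' m | D D' m | D D' m | D D' _ [e h]
  | D D' D'' _ [e h] _ [e' h']].
- exact/same_invariant_linking/same_diagram_invariant.
- exact/same_invariant_linking/move1_invariant.
- exact/same_invariant_linking/move2_invariant.
- exact/same_invariant_linking/move3_invariant.
- by split=> // C C' vC vC'; rewrite -e; apply/laurent_eqmod_sym/h.
split; first by rewrite e.
(* Transitivity needs valid choices for the middle diagram. *)
move=> C C'' vC vC''; have [C' vC'] := choices_exist (wf_vdiagram D').
by apply: laurent_eqmod_trans (h C C' vC vC') _; rewrite e; apply: h'.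
Qed.

(** For a single diagram this is the independence of colorings and lifts. *)
Lemma same_linking_refl (D : vdiagram) : same_linking D D.
Proof.
have [L lab] := labeling_exists (wf_vdiagram D).
apply: same_invariant_linking; split=> //; exists L, L; split=> //.
exact: laurent_eqmod_refl.
Qed.

Theorem theorem5p4 :
  (forall D : vdiagram,
     (exists C : choices, valid_choices (gauss D) C) /\
     (forall C C' : choices,
        valid_choices (gauss D) C -> valid_choices (gauss D) C' ->
        laurent_eqmod (link_span (gauss D))
          (linking_polynomial D C) (linking_polynomial D C'))) /\
  (forall D D' : vdiagram, vlink_equiv D D' ->
     link_span (gauss D) = link_span (gauss D') /\
     (forall C C' : choices,
        valid_choices (gauss D) C -> valid_choices (gauss D') C' ->
        laurent_eqmod (link_span (gauss D))
          (linking_polynomial D C) (linking_polynomial D' C'))).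
Proof.
split=> [D|]; last exact: vlink_equiv_linking.
split; first exact/choices_exist/wf_vdiagram.
exact: (same_linking_refl D).2.
Qed.
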